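(* Let $n \geq 1$, let $a_1, \dots, a_n, b \in \mathbb{Z}$ with $a_i \neq 0$ for all $i$, and suppose that $d = \gcd(a_1, \dots, a_n)$ divides $b$. Then the equation $\sum_{i=1}^{n} a_i x_i = b$ has infinitely many solutions $(x_1, \dots, x_n) \in \mathbb{N}^n$ if and only if it has variations of sign.
   Context: $\mathbb{N}$ denotes the set of natural numbers including $0$. The equation $\sum_{i=1}^{n} a_i x_i = b$ is said to have variations of sign if there exist indices $i, j$ with $1 \leq i, j \leq n$ such that $\operatorname{sign}(a_i \cdot a_j) = -1$, i.e. at least two coefficients have opposite signs. *)

(* Defs.v *)
From mathcomp Require Import all_boot all_order all_algebra.
From mathcomp Require Import classical_sets cardinality.

Set Implicit Arguments.
Unset Strict Implicit.
Unset Printing Implicit Defensive.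

Import Order.TTheory GRing.Theory Num.Theory.

Local Open Scope ring_scope.

Definition solutions (n : nat) (a : 'I_n -> int) (b : int) :
    set {ffun 'I_n -> nat} :=
  [set x : {ffun 'I_n -> nat} | \sum_(i < n) a i * (x i)%:Z = b]%classic.

Definition variations_of_sign (n : nat) (a : 'I_n -> int) : Prop :=
  exists i j : 'I_n, Num.sg (a i * a j) = -1.

(* Main.v *)
(** If all coefficients have the same sign then multiplying the equation by one
    of them makes all coefficients positive, which bounds every coordinate of a
    solution in N^n.  Otherwise let P be the sum of the positive coefficients
    and - N the sum of the negative ones: the vector z with value N at the
    positive coefficients and P at the negative ones is a strictly positive
    solution of the homogeneous equation, and if u is an integer solution given
    by Bezout, then u + t z is a solution in N^n for all large t. *)
Require Import Defs.
From mathcomp Require Import all_boot all_order all_algebra.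
From mathcomp Require Import classical_sets cardinality.
From mathcomp Require Import boolp zify ring.

Set Implicit Arguments.
Unset Strict Implicit.
Unset Printing Implicit Defensive.

Import Order.TTheory GRing.Theory Num.Theory.

Local Open Scope ring_scope.

(** Being an integer combination of the [a i] holds for [0] and for each [a i], and binary Bezout
    carries it over to the gcd of two such combinations. *)
Lemma bezout_bigop (I : finType) (a : I -> int) :
  exists u : I -> int, \sum_i a i * u i = \big[gcdz/0]_i a i.
Proof.
apply: (big_ind (fun d => exists u : I -> int, \sum_i a i * u i = d)).
- by exists (fun=> 0); apply: big1 => i _; rewrite mulr0.
- move=> x y [u <-] [v <-].
  have [p [q <-]] := Bezoutz (\sum_i a i * u i) (\sum_i a i * v i).
  exists (fun i => p * u i + q * v i).
  by rewrite !mulr_sumr -big_split /=; apply: eq_bigr => i _; ring.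
- move=> i _; exists (fun j => (j == i)%:Z).
  rewrite (bigD1 i) //= eqxx mulr1 big1 ?addr0 // => j /negbTE->.
  by rewrite mulr0.
Qed.

Lemma positive_homogeneous_solution (I : finType) (a : I -> int) (p q : I) :
    0 < a p -> a q < 0 ->
  exists2 z : I -> int, forall i, 0 < z i & \sum_i a i * z i = 0.
Proof.
move=> ap aq.
(* Zero coefficients fall under [N], where they add nothing. *)
pose P := \sum_(i | 0 < a i) a i; pose N := \sum_(i | ~~ (0 < a i)) - a i.
have P0 : 0 < P.
  rewrite /P (bigD1 p) //= ltr_wpDr // sumr_ge0 // => i /andP[+ _].
  exact: ltW.
have N0 : 0 < N.
  rewrite /N (bigD1 q) /=; last by rewrite -leNgt ltW.
  rewrite ltr_wpDr ?oppr_gt0 // sumr_ge0 // => i /andP[+ _].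
  by rewrite -leNgt oppr_ge0.
exists (fun i => if 0 < a i then N else P) => [i|]; first by case: ifP.
rewrite (bigID (fun i => 0 < a i)) /=.
under eq_bigr => i -> do [].
under [X in _ + X]eq_bigr => i /negbTE-> do [].
rewrite -!mulr_suml -/P.
have -> : \sum_(i | ~~ (0 < a i)) a i = - N by rewrite /N sumrN opprK.
by ring.
Qed.

Lemma finite_solutions_pos (n : nat) (a : 'I_n -> int) (b : int) :
  (forall i, 0 < a i) -> finite_set (solutions a b).
Proof.
move=> a0.
(* Since [a i >= 1], a solution has [x i <= b], so it comes from a map into a fixed finite
   ordinal. *)
pose f (y : {ffun 'I_n -> 'I_`|b|.+1}) : {ffun 'I_n -> nat} :=
  [ffun i => y i : nat].
apply: (@sub_finite_set _ _ (f @` setT)%classic); last first.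
  exact/finite_image/finite_finset.
move=> x /= xb; exists [ffun i => inord (x i)] => //.
apply/ffunP => i; rewrite !ffunE inordK //.
have xiab : a i * (x i)%:Z <= b.
  rewrite -xb (bigD1 i) //= lerDl sumr_ge0 // => j _.
  by rewrite mulr_ge0 // ltW.
have := a0 i; nia.
Qed.

Lemma infinite_solutions (n : nat) (a : 'I_n -> int) (b : int)
    (u z : 'I_n -> int) (i0 : 'I_n) :
    (forall i, 0 < z i) ->
    \sum_i a i * u i = b -> \sum_i a i * z i = 0 ->
  infinite_set (solutions a b).
Proof.
move=> z0 ub az0.
(* [M] bounds the absolute value of every [u i] and [z i >= 1], so the shift by [M] makes [w t]
   nonnegative already from [t = 0]. *)
pose M : nat := \sum_i `|u i|%N.
pose w (t : nat) i := u i + (t + M)%N%:Z * z i.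
have w0 t i : 0 <= w t i.
  have uM : (`|u i| <= M)%N by rewrite /M (bigD1 i) //= leq_addr.
  have := z0 i; rewrite /w; nia.
pose f t : {ffun 'I_n -> nat} := [ffun i => `|w t i|%N].
have f_inj : injective f.
  (* The values at [i0] already separate the [f t], as [z i0] is nonzero. *)
  move=> s t /ffunP/(_ i0); rewrite !ffunE => /(congr1 Posz).
  rewrite !gez0_abs // /w => /addrI/(mulIf (lt0r_neq0 (z0 i0)))[].
  exact: addIn.
have fE t : solutions a b (f t).
  rewrite /solutions /=.
  under eq_bigr do rewrite ffunE gez0_abs // /w mulrDr mulrCA.
  by rewrite big_split /= ub -mulr_sumr az0 mulr0 addr0.
move=> /(finite_preimage (f := f) (in2W f_inj)).
have -> : (f @^-1` solutions a b = setT)%classic by rewrite -subTset => t _; exact: fE.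
exact: infinite_nat.
Qed.

Theorem theorem1 (n : nat) (hn : (1 <= n)%N) (a : 'I_n -> int) (b : int)
    (ha : forall i : 'I_n, a i != 0)
    (hd : (\big[gcdz/0]_(i < n) a i %| b)%Z) :
  infinite_set (solutions a b) <-> variations_of_sign a.
Proof.
split=> [inf|[i [j]]].
  apply: contrapT => no_var; apply: inf.
  pose c := a (Ordinal hn).
  apply: (@sub_finite_set _ _ (solutions (fun i => c * a i) (c * b))).
    move=> x; rewrite /solutions /= => <-.
    by rewrite mulr_sumr; apply: eq_bigr => i _; rewrite mulrA.
  (* If [c * a i <= 0], this nonzero product is negative: a variation of sign. *)
  apply: finite_solutions_pos => i; rewrite ltNge; apply/negP => ca.
  apply: no_var; exists (Ordinal hn), i; apply: ltr0_sg.
  by rewrite lt_neqAle ca mulf_neq0 ?ha.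
move=> /eqP; rewrite sgr_cp0 => aij.
have [p [q [ap aq]]] : exists p q, 0 < a p /\ a q < 0.
  have [ai|ai] := ltP 0 (a i).
    by exists i, j; rewrite -(pmulr_rlt0 _ ai).
  have {}ai : a i < 0 by rewrite lt_neqAle ha.
  by exists j, i; rewrite -(nmulr_rlt0 _ ai).
have [z z0 az0] := positive_homogeneous_solution ap aq.
have [u ud] := bezout_bigop a; have /dvdzP[k ->] := hd.
(* [u] attains the gcd, so [k * u] attains [k] times it; [p] supplies the coordinate [i0]. *)
apply: (infinite_solutions (u := fun i => k * u i) p z0 _ az0).
by rewrite -ud mulr_sumr; apply: eq_bigr => l _; ring.
Qed.
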